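(* Let $A\in\mathbb{S}$. Then the following are true. (a) $\lambda$ is an eigenvalue of $A$ if and only if $\epsilon_2\lambda^\star$ is an eigenvalue of $A$; moreover the partial multiplicities corresponding to $\epsilon_2\lambda^\star$ are equal to those corresponding to $\lambda$. (b) Let $(\lambda_1,X_1)$ and $(\lambda_2,X_2)$ be Jordan pairs of $A$. Then $X_1^\star HX_2=0$ if $\lambda_2\ne\epsilon_2\lambda_1^\star$. Thus in that case, if $X=\begin{bmatrix}X_1&X_2\end{bmatrix}$, then $X^\star HX=\mathrm{diag}(X_1^\star HX_1,\,X_2^\star HX_2)$. In particular, if $(\lambda,X)$ is a Jordan pair of $A$ and $\lambda\ne\epsilon_2\lambda^\star$, then $X^\star HX=0$. (c) Let $(\lambda,X)$ be a Jordan pair of $A$ with $\lambda\ne\epsilon_2\lambda^\star$. Then there exists another Jordan pair $(\epsilon_2\lambda^\star,\tilde{X})$ of $A$ with $\#(\tilde{X})=\#(X)$, and for $X_0=\begin{bmatrix}X&\tilde{X}\end{bmatrix}$ one has $$X_0^\star HX_0=\begin{bmatrix}0&X^\star H\tilde{X}\\ \epsilon_1(X^\star H\tilde{X})^\star&0\end{bmatrix}.$$ (d) If $\lambda=\epsilon_2\lambda^\star$ is an eigenvalue of $A$ with right eigenvector $x$, then $Hx$ is a corresponding left eigenvector, i.e. $(Hx)^\star A=\lambda(Hx)^\star$. However, in this case $\langle x,x\rangle_H$ need not be zero (i.e. it is not true in general that $\langle x,x\rangle_H=0$).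
   Context: $\mathbb{K}\in\{\mathbb{R},\mathbb{C}\}$; $\star=*$ (conjugate transpose) if $\mathbb{K}=\mathbb{C}$ and $\star=T$ (transpose) if $\mathbb{K}=\mathbb{R}$. For a scalar, $\lambda^\star=\overline{\lambda}$ if $\star=*$ and $\lambda^\star=\lambda$ if $\star=T$. $H\in\mathbb{K}^{n\times n}$ is a fixed unitary matrix (orthogonal if $\mathbb{K}=\mathbb{R}$) with $H^\star=\epsilon_1H$, $\epsilon_1\in\{1,-1\}$, and $\langle x,y\rangle_H=y^\star Hx$. For $A\in\mathbb{K}^{n\times n}$ put $A^{[\star]}=H^{-1}A^\star H$; $\mathbb{L}=\{A:A^{[\star]}=-A\}$, $\mathbb{J}=\{A:A^{[\star]}=A\}$; $\mathbb{S}\in\{\mathbb{L},\mathbb{J}\}$, with $\epsilon_2=1$ if $\mathbb{S}=\mathbb{J}$ and $\epsilon_2=-1$ if $\mathbb{S}=\mathbb{L}$. Eigenvalues, eigenvectors and Jordan chains may be complex. A Jordan pair of $A$ is a pair $(\lambda,X)$ where $\lambda$ is an eigenvalue of $A$ and the columns of $X$ are the (linearly independent) vectors of a Jordan chain for $\lambda$, ordered so that $AX=XJ(\lambda)$, with $J(\lambda)$ the upper triangular Jordan block with eigenvalue $\lambda$ of size $\#(X)$, the number of columns of $X$. The partial multiplicities of an eigenvalue are the sizes of its Jordan blocks in the Jordan form. *)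

(* Defs.v *)
From HB Require Import structures.
From mathcomp Require Import all_boot all_order all_algebra.
From mathcomp Require Import reals complex.

Set Implicit Arguments.
Unset Strict Implicit.
Unset Printing Implicit Defensive.

Import Order.TTheory GRing.Theory Num.Theory.
Local Open Scope ring_scope.

Inductive ground_field := RealField | ComplexField.

Inductive matrix_class := LieClass | JordanClass.

Section Definitions.
Variable R : realType.
Local Notation C := R[i].

(* Eigenvalues and Jordan chains are complex even for real A, so 'M[K]_(m, p)
   is represented as the subset [over K] of 'M[C]_(m, p). *)
Definition over (K : ground_field) m p (M : 'M[C]_(m, p)) : Prop :=
  match K with
  | RealField => M \is a mxOver Num.real
  | ComplexField => True
  end.

Definition scalar_star (K : ground_field) (a : C) : C :=
  match K with
  | RealField => a
  | ComplexField => Num.conj a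
  end.

(* For K = RealField this is the plain transpose also on matrices with
   non-real entries (such as those whose columns are Jordan chains). *)
Definition star (K : ground_field) m p (M : 'M[C]_(m, p)) : 'M[C]_(p, m) :=
  map_mx (scalar_star K) M^T.

(* On matrices with real entries, [unitarymx] is orthogonality. *)
Definition form_matrix (K : ground_field) n (eps1 : C) (H : 'M[C]_n) : Prop :=
  [/\ eps1 = 1 \/ eps1 = -1, over K H, H \is unitarymx
    & star K H = eps1 *: H].

Definition ip (K : ground_field) n (H : 'M[C]_n) (x y : 'cV[C]_n) : C :=
  (star K y *m H *m x) 0 0.

Definition adj (K : ground_field) n (H A : 'M[C]_n) : 'M[C]_n :=
  invmx H *m star K A *m H.

Definition eps2 (S : matrix_class) : C :=
  match S with
  | LieClass => -1
  | JordanClass => 1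
  end.

Definition in_class (K : ground_field) (S : matrix_class) n (H A : 'M[C]_n)
    : Prop :=
  over K A /\
  match S with
  | LieClass => adj K H A = - A
  | JordanClass => adj K H A = A
  end.

Definition jordan_block k (lambda : C) : 'M[C]_k :=
  \matrix_(i < k, j < k)
    (if i == j then lambda else if i.+1 == j :> nat then 1 else 0).

(* The size #(X) of the chain is the number k of columns of X. The condition
   [row_free X^T] is linear independence of these columns. *)
Definition jordan_pair n k (A : 'M[C]_n) (lambda : C) (X : 'M[C]_(n, k))
    : Prop :=
  [/\ (0 < k)%N, eigenvalue A lambda, row_free X^T
    & A *m X = X *m jordan_block k lambda].

(* A list of pairs (eigenvalue, size) encodes a direct sum of Jordan blocks. *)
Definition jordan_matrix (s : seq (C * nat)) :=
  \mxdiag_(i < size s)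
    jordan_block (tnth (in_tuple s) i).2 (tnth (in_tuple s) i).1.

(* The total size of the blocks is only propositionally equal to n, so the
   invertible change of basis P is rectangular with a two-sided inverse Q. *)
Definition jordan_form n (A : 'M[C]_n) (s : seq (C * nat)) : Prop :=
  all (fun b => 0 < b.2)%N s /\
  exists P Q, [/\ P *m Q = 1%:M, Q *m P = 1%:M
                & A = P *m jordan_matrix s *m Q].

Definition partial_mults (s : seq (C * nat)) (lambda : C) : seq nat :=
  [seq b.2 | b <- s & b.1 == lambda].

Definition right_eigenvector n (A : 'M[C]_n) (lambda : C) (x : 'cV[C]_n)
    : Prop :=
  x != 0 /\ A *m x = lambda *: x.

Definition left_eigenvector (K : ground_field) n (A : 'M[C]_n) (lambda : C)
    (y : 'cV[C]_n) : Prop :=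
  y != 0 /\ star K y *m A = lambda *: star K y.

End Definitions.

Arguments eps2 {R} S.

(* Main.v *)
Require Import Defs.
From HB Require Import structures.
From mathcomp Require Import all_boot all_order all_algebra.
From mathcomp Require Import reals complex.
From mathcomp Require Import zify.

(* Put mu(a) = eps2 * a^star.  Everything comes from the intertwining identity
   (A - a)^star H = eps2 H (A - mu(a)) and its powers.  It forces
   rank (A - mu(a))^m = rank (A - a)^m for all m; these ranks determine the
   partial multiplicities, and a chain of length k for a exists if and only if
   rank (A - a)^k < rank (A - a)^(k-1), which gives (a) and the chain in (c)
   without Jordan's theorem.  For (b), X1^star H X2 (J2 - mu(a1))^k1 vanishes
   because (A - a1)^k1 X1 = 0, while J2 - mu(a1) is invertible when
   a2 <> mu(a1). *)

Set Implicit Arguments.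
Unset Strict Implicit.
Unset Printing Implicit Defensive.

Import Order.TTheory GRing.Theory Num.Theory.
Local Open Scope ring_scope.

(** * Ranks of products, powers of block-diagonal matrices, and multisets of block sizes *)

Lemma eigenvalue_mxrank (F : fieldType) n (A : 'M[F]_n) (a : F) :
  eigenvalue A a = (\rank (A - a%:M) != n).
Proof. by rewrite /eigenvalue /eigenspace kermx_eq0. Qed.

(** [M] is recovered as [Q *m (P *m M *m Q) *m P], so each rank bounds the other. A rectangular [P]
    fits the change of basis in [jordan_form]. *)
Lemma mxrank_sandwich (F : fieldType) m n (P : 'M[F]_(m, n)) (Q : 'M_(n, m))
    (M : 'M_n) : Q *m P = 1%:M -> \rank (P *m M *m Q) = \rank M.
Proof.
move=> QP; apply/eqP; rewrite eqn_leq.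
rewrite (leq_trans (mxrankM_maxl _ _) (mxrankM_maxr _ _)) /=.
have {1}-> : M = Q *m (P *m M *m Q) *m P.
  by rewrite !mulmxA QP mul1mx -mulmxA QP mulmx1.
exact: leq_trans (mxrankM_maxl _ _) (mxrankM_maxr _ _).
Qed.

(** Multiplying by [U'] and [V'] turns the product into the identity of size [r]; this reads a rank
    off a full-rank factorization. *)
Lemma mxrank_section_retraction (F : fieldType) m n r (U : 'M[F]_(m, r))
    (V : 'M_(r, n)) U' V' :
  U' *m U = 1%:M -> V *m V' = 1%:M -> \rank (U *m V) = r.
Proof.
move=> U'U VV'; apply/eqP; rewrite eqn_leq.
rewrite (leq_trans (mxrankM_maxl _ _) (rank_leq_col _)) /=.
have rE : \rank (U' *m (U *m V) *m V') = r.
  by rewrite mulmxA U'U mul1mx VV' mxrank1.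
apply: leq_trans (eq_leq (esym rE)) _.
exact: leq_trans (mxrankM_maxl _ _) (mxrankM_maxr _ _).
Qed.

Lemma col_mul (R : pzSemiRingType) m n p (M : 'M[R]_(m, n)) (N : 'M_(n, p)) j :
  col j (M *m N) = M *m col j N.
Proof. by rewrite !colE mulmxA. Qed.

Lemma mul_mxdiag (R : pzSemiRingType) p (p_ : 'I_p -> nat)
    (D_ E_ : forall i, 'M[R]_(p_ i)) :
  \mxdiag_i D_ i *m \mxdiag_i E_ i = \mxdiag_i (D_ i *m E_ i).
Proof.
rewrite [X in _ *m X]/mxdiag mul_mxdiag_mxblock; apply: eq_mxblock => i j.
(* Eliminating [e : i = j] makes the two block sizes coincide, so the size cast [conform_mx] is
   trivial. *)
by case: eqP => [e|_]; [case: _ / e; rewrite !conform_mx_id | rewrite mulmx0].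
Qed.

Lemma mxdiagX (R : pzSemiRingType) p (p_ : 'I_p -> nat)
    (D_ : forall i, 'M[R]_(p_ i)) k :
  (\mxdiag_i D_ i) ^+ k = \mxdiag_i (D_ i ^+ k).
Proof.
elim: k => [|k IH]; first by rewrite expr0 -[LHS]/(1%:M) -mxdiagZ.
rewrite exprS IH -mulmxE mul_mxdiag; apply: eq_mxdiag => i.
by rewrite exprS.
Qed.

(* [minn x m] is the codimension of the image of the [m]-th power of the
   nilpotent Jordan block of size [x]. *)
Lemma perm_eq_sum_minn (s t : seq nat) :
  all (leq 1) s -> all (leq 1) t ->
  (forall m, \sum_(x <- s) minn x m = \sum_(x <- t) minn x m)%N ->
  perm_eq s t.
Proof.
move=> s_gt0 t_gt0 st.
(* Raising [m] by one increases [minn x m] by one exactly when [x > m], so differences of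
   consecutive sums count the entries above [m]. *)
have cgt m : count (leq m.+1) s = count (leq m.+1) t.
  have cE (u : seq nat) : (count (leq m.+1) u + \sum_(x <- u) minn x m
                           = \sum_(x <- u) minn x m.+1)%N.
    rewrite -sum1_count [X in (X + _)%N]big_mkcond -big_split /=.
    by apply: eq_bigr => x _; case: ifP; lia.
  by apply/eqP; rewrite -(eqn_add2r (\sum_(x <- s) minn x m)%N) {2}st !cE st.
apply/allP => x _; apply/eqP => /=.
(* Zeros are invisible to the sums; positivity excludes them. *)
case: x => [|x].
  have c0 (u : seq nat) : all (leq 1) u -> count_mem 0%N u = 0%N.
    by move=> u_gt0; apply/count_memPn; apply/negP => /(allP u_gt0).
  by rewrite !c0.
have cE (u : seq nat) : (count_mem x.+1 u + count (leq x.+2) u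
                         = count (leq x.+1) u)%N.
  rewrite -!sum1_count [X in (X + _)%N]big_mkcond.
  rewrite [X in (_ + X)%N]big_mkcond [RHS]big_mkcond -big_split /=.
  by apply: eq_bigr => y _ /=; case: (ltngtP y x.+1) => /=; lia.
by apply/eqP; rewrite -(eqn_add2r (count (leq x.+2) s)) {2}cgt !cE cgt.
Qed.

(** * Jordan blocks, forms and chains, and their link with ranks of powers *)

Section JordanChains.
Variable R : realType.
Local Notation C := R[i].

Lemma jordan_block_shift k (a b : C) :
  jordan_block k a - b%:M = jordan_block k (a - b).
Proof.
apply/matrixP => i j; rewrite !mxE.
by case: eqP => _; rewrite ?mulr1n ?mulr0n ?subr0.
Qed.

Lemma jordan_block_unit k (a : C) : a != 0 -> jordan_block k a \in unitmx.
Proof.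
move=> a0; rewrite -unitmx_tr unitmxE det_trig; last first.
  apply/is_trig_mxP => i j ij; rewrite !mxE.
  by case: eqP ij => [->|_]; [rewrite ltnn | case: eqP => //; lia].
by rewrite unitfE prodf_seq_neq0; apply/allP => i _; rewrite !mxE eqxx.
Qed.

Lemma jordan_block0X k m :
  (jordan_block k (0 : C)) ^+ m
  = \matrix_(i < k, j < k) ((i + m)%N == j)%:R.
Proof.
elim: m => [|m IH].
  by apply/matrixP => i j; rewrite !mxE addn0.
rewrite exprSr IH -mulmxE; apply/matrixP => i j; rewrite !mxE.
case: (ltnP (i + m) k) => [imk|kim].
  rewrite (bigD1 (Ordinal imk)) //= big1 => [|l /negPf ne].
    rewrite !mxE eqxx mul1r addr0 -val_eqE /= -addnS.
    by case: ifP => [/eqP <-|_]; case: eqP => //; lia.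
  by rewrite mxE eq_sym -[_ == _]/(l == Ordinal imk) ne mul0r.
rewrite big1 => [|l _]; last first.
  by rewrite mxE; case: eqP; [have := ltn_ord l; lia | rewrite mul0r].
by case: eqP => //; have := ltn_ord j; lia.
Qed.

(** The power factors through dimension [k - m]: [U] includes the first [k - m] coordinates, [V]
    selects the last ones, and their transposes are one-sided inverses. Truncated subtraction covers
    [m >= k]. *)
Lemma mxrank_jordan_block0X k m :
  \rank ((jordan_block k (0 : C)) ^+ m) = (k - m)%N.
Proof.
pose U : 'M[C]_(k, k - m) := \matrix_(i, a) (i == a :> nat)%:R.
pose V : 'M[C]_(k - m, k) := \matrix_(a, j) ((a + m)%N == j)%:R.
have -> : jordan_block k (0 : C) ^+ m = U *m V.
  rewrite jordan_block0X; apply/matrixP => i j; rewrite !mxE.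
  case: (ltnP i (k - m)) => [ikm|kim].
    rewrite (bigD1 (Ordinal ikm)) //= big1 => [|l /negPf ne].
      by rewrite !mxE eqxx mul1r addr0.
    by rewrite mxE eq_sym -[_ == _]/(l == Ordinal ikm) ne mul0r.
  rewrite big1 => [|l _]; last first.
    by rewrite mxE; case: eqP; [have := ltn_ord l; lia | rewrite mul0r].
  by case: eqP => //; have := ltn_ord j; lia.
apply: (mxrank_section_retraction (U' := U^T) (V' := V^T)).
  apply/matrixP => a b; rewrite !mxE.
  have ak : (a < k)%N by have := ltn_ord a; lia.
  rewrite (bigD1 (Ordinal ak)) //= big1 => [|l /negPf ne].
    by rewrite !mxE eqxx mul1r addr0.
  by rewrite !mxE -[_ == _ :> nat]/(l == Ordinal ak) ne mul0r.
apply/matrixP => a b; rewrite !mxE.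
have ak : (a + m < k)%N by have := ltn_ord a; lia.
rewrite (bigD1 (Ordinal ak)) //= big1 => [|l /negPf ne].
  by rewrite !mxE eqxx mul1r addr0 eqn_add2r eq_sym.
by rewrite !mxE eq_sym -[_ == _ :> nat]/(l == Ordinal ak) ne mul0r.
Qed.

Lemma jordan_block0X_eq0 k m : (k <= m)%N -> jordan_block k (0 : C) ^+ m = 0.
Proof.
by move=> km; apply/eqP; rewrite -mxrank_eq0 mxrank_jordan_block0X subn_eq0.
Qed.

Lemma jordan_blockX_unit k (a : C) m :
  a != 0 -> jordan_block k a ^+ m \in unitmx.
Proof.
move=> a0; elim: m => [|m IH]; first by rewrite expr0 unitmx1.
by rewrite exprS -mulmxE unitmx_mul jordan_block_unit.
Qed.

(** The shifted block is nilpotent if [a = b] and invertible otherwise. The additive form can be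
    summed over blocks without truncated subtraction. *)
Lemma mxrank_jordan_blockX k m (a b : C) :
  (\rank ((jordan_block k a - b%:M) ^+ m) + (if a == b then minn k m else 0)
   = k)%N.
Proof.
rewrite jordan_block_shift; case: eqP => [->|/eqP ab].
  by rewrite subrr mxrank_jordan_block0X; lia.
by rewrite addn0 mxrank_unit // jordan_blockX_unit // subr_eq0.
Qed.

Lemma jordan_formX n (A : 'M[C]_n) (s : seq (C * nat)) (P : 'M_(n, _)) Q
    (b : C) m :
  P *m Q = 1%:M -> Q *m P = 1%:M -> A = P *m jordan_matrix s *m Q ->
  (A - b%:M) ^+ m = P *m (jordan_matrix s - b%:M) ^+ m *m Q.
Proof.
move=> PQ QP ->; set J := jordan_matrix s.
have -> : P *m J *m Q - b%:M = P *m (J - b%:M) *m Q.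
  by rewrite mulmxBr mulmxBl mul_mx_scalar -scalemxAl PQ scalemx1.
elim: m => [|m IH]; first by rewrite !expr0 mulmx1 PQ.
rewrite 2!exprS IH -!mulmxE -!mulmxA; congr (_ *m (_ *m _)).
by rewrite [Q *m _]mulmxA QP mul1mx.
Qed.

(** Ranks add over diagonal blocks, and only blocks with eigenvalue [b] lose rank. *)
Lemma jordan_form_mxrank n (A : 'M[C]_n) (s : seq (C * nat)) (b : C) m :
  jordan_form A s ->
  (\rank ((A - b%:M) ^+ m) + \sum_(x <- partial_mults s b) minn x m
   = \sum_(x <- s) x.2)%N.
Proof.
move=> [_ [P [Q [PQ QP AE]]]].
rewrite (jordan_formX _ _ PQ QP AE) mxrank_sandwich //.
rewrite /jordan_matrix -mxdiagZ -mxdiagB mxdiagX rank_mxdiag.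
rewrite big_map big_filter !(big_tnth _ _ s).
rewrite [X in (_ + X)%N]big_mkcond -big_split /=.
by apply: eq_bigr => i _; exact: mxrank_jordan_blockX.
Qed.

Lemma partial_mults_gt0 n (A : 'M[C]_n) s b :
  jordan_form A s -> all (leq 1) (partial_mults s b).
Proof.
move=> [s_gt0 _]; rewrite all_map all_filter.
by apply: sub_all s_gt0 => x /= ->; apply/implyP.
Qed.

Lemma perm_partial_mults n (A : 'M[C]_n) s (a b : C) :
  jordan_form A s ->
  (forall m, \rank ((A - a%:M) ^+ m) = \rank ((A - b%:M) ^+ m)) ->
  perm_eq (partial_mults s a) (partial_mults s b).
Proof.
move=> As ab; apply: perm_eq_sum_minn => [||m].
- exact: partial_mults_gt0 As.
- exact: partial_mults_gt0 As.
apply/eqP; rewrite -(eqn_add2l (\rank ((A - a%:M) ^+ m))).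
by rewrite jordan_form_mxrank // ab jordan_form_mxrank.
Qed.

Lemma jordan_chainX n k (A : 'M[C]_n) a b (X : 'M_(n, k)) m :
  A *m X = X *m jordan_block k a ->
  (A - b%:M) ^+ m *m X = X *m jordan_block k (a - b) ^+ m.
Proof.
move=> AX; elim: m => [|m IH]; first by rewrite !expr0 mul1mx mulmx1.
rewrite 2!exprS -!mulmxE -mulmxA IH !mulmxA mulmxBl AX.
by rewrite mul_scalar_mx -mul_mx_scalar -mulmxBr jordan_block_shift.
Qed.

(** Without a rank drop, the power [k.-1] would be a left multiple of the power [k], hence would
    kill [X]. But it acts on [X] through a block power of rank 1, and the columns of [X] are
    independent. *)
Lemma jordan_pair_mxrank n k (A : 'M[C]_n) a (X : 'M_(n, k)) :
  jordan_pair A a X ->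
  (\rank ((A - a%:M) ^+ k) < \rank ((A - a%:M) ^+ k.-1))%N.
Proof.
move=> [k0 _ freeX AX]; set B := A - a%:M.
have Bk : B ^+ k = B *m B ^+ k.-1 by rewrite -{1}(prednK k0) exprS.
have sub : (B ^+ k <= B ^+ k.-1)%MS by rewrite Bk submxMl.
rewrite (ltn_leqif (mxrank_leqif_sup sub)); apply/negP => /submxP[D BD].
have : X *m jordan_block k 0 ^+ k.-1 = 0.
  have chain m : B ^+ m *m X = X *m jordan_block k 0 ^+ m.
    by rewrite (jordan_chainX _ _ AX) subrr.
  by rewrite -chain BD -mulmxA chain jordan_block0X_eq0 // !mulmx0.
move/(congr1 trmx); rewrite trmx_mul trmx0 => /eqP.
rewrite -mxrank_eq0 mxrankMfree // mxrank_tr mxrank_jordan_block0X.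
by rewrite subn_eq0; lia.
Qed.

(** The rank drop yields [v] killed by [B ^+ k] but not by [B ^+ k.-1]; the chain is
    [B ^+ k.-1 *m v], ..., [B *m v], [v]. *)
Lemma jordan_pair_exists n k (A : 'M[C]_n) a :
  (0 < k)%N -> eigenvalue A a ->
  (\rank ((A - a%:M) ^+ k) < \rank ((A - a%:M) ^+ k.-1))%N ->
  exists X : 'M_(n, k), jordan_pair A a X.
Proof.
move=> k0 eigA; set B := A - a%:M => rk.
have [v Bv0 Bvn0] : exists2 v : 'cV_n, B ^+ k *m v = 0 & B ^+ k.-1 *m v != 0.
  (* [%MS] compares row spaces, so non-inclusion means that some column of the cokernel of [B ^+ k]
     survives [B ^+ k.-1]; that column is [v]. *)
  have : ~~ (B ^+ k.-1 <= B ^+ k)%MS.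
    by apply: contraL rk => /mxrankS; rewrite -leqNgt.
  rewrite submxE; set W := cokermx _ => W0.
  have [j] : exists j, col j (B ^+ k.-1 *m W) != 0.
    apply/existsP; apply: contraR W0 => /existsPn h.
    apply/eqP/matrixP => i j.
    by move: (h j) => /negPn/eqP/matrixP/(_ i 0); rewrite !mxE.
  rewrite col_mul => jn0; exists (col j W) => //.
  by rewrite -col_mul mulmx_coker col0.
pose x m := B ^+ m *m v.
have x0 m : (k <= m)%N -> x m = 0.
  by move=> km; rewrite /x -(subnK km) exprD -mulmxE -mulmxA Bv0 mulmx0.
have Bx p m : B ^+ p *m x m = x (p + m)%N.
  by rewrite /x mulmxA mulmxE -exprD.
pose X : 'M_(n, k) := \matrix_(i, j) x (k.-1 - j)%N i 0.
have XE i j : X i j = x (k.-1 - j)%N i 0 by rewrite mxE.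
have colX j : col j X = x (k.-1 - j)%N.
  by apply/colP => i; rewrite !mxE.
exists X; split => //.
- apply: inj_row_free => u uX; apply/eqP/negPn/negP => /rV0Pn[j0 uj0].
  (* With [j] the last index of a nonzero coefficient, [B ^+ j] kills all columns before [j] and
     sends column [j] to [x k.-1], which is nonzero. *)
  have [j uj jmax] := @arg_maxnP _ j0 (fun j => u 0 j != 0) val uj0.
  have /(congr1 (fun y => B ^+ j *m y^T)) := uX.
  rewrite trmx_mul trmxK trmx0 mulmx0 => /eqP; apply/negP.
  suff -> : B ^+ j *m (X *m u^T) = u 0 j *: x k.-1.
    by rewrite scalemx_eq0 negb_or uj.
  have -> : X *m u^T = \sum_l u 0 l *: x (k.-1 - l)%N.
    apply/colP => i; rewrite mxE summxE; apply: eq_bigr => l _.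
    by rewrite !mxE mulrC.
  rewrite mulmx_sumr (bigD1 j) //= big1 => [|l lj].
    by rewrite addr0 -scalemxAr Bx subnKC //; have := ltn_ord j; lia.
  have [->|ul] := eqVneq (u 0 l) 0; first by rewrite scale0r mulmx0.
  have := jmax _ ul; rewrite /= => lej.
  rewrite -scalemxAr Bx x0 ?scaler0 //.
  have := ltn_ord j; move: lj; rewrite -val_eqE /=; lia.
(* Removing the scalar part from both sides leaves the nilpotent relation for [B]. *)
- have -> : A = B + a%:M by rewrite subrK.
  have -> : jordan_block k a = jordan_block k 0 + a%:M.
    by apply/eqP; rewrite -subr_eq jordan_block_shift subrr.
  rewrite mulmxDl mulmxDr mul_scalar_mx mul_mx_scalar; congr (_ + _).
  apply/matrixP => i j.
  have -> : (B *m X) i j = x (k - j)%N i 0.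
    have := colX j => /(congr1 (fun y => B *m y)).
    rewrite -col_mul => /colP/(_ i); rewrite mxE => ->.
    rewrite -[B]expr1 Bx; congr (x _ _ _); have := ltn_ord j; lia.
  (* The first column is sent to [x k = 0], and column [j > 0] to column [j.-1]. *)
  rewrite [RHS]mxE; case: (posnP j) => [j0|j0].
    rewrite j0 subn0 x0 // mxE big1 // => l _.
    by rewrite [jordan_block _ _ _ _]mxE j0; case: eqP; rewrite mulr0.
  have jk : (j.-1 < k)%N by have := ltn_ord j; lia.
  rewrite (bigD1 (Ordinal jk)) //= big1 => [|l lj].
    rewrite XE [jordan_block _ _ _ _]mxE /= prednK // eqxx -val_eqE /=.
    have -> : (j.-1 == j)%N = false by lia.
    rewrite mulr1 addr0; congr (x _ _ _); lia.
  rewrite [jordan_block _ _ _ _]mxE.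
  have -> : (l.+1 == j)%N = false.
    by move: lj; rewrite -val_eqE /=; lia.
  by case: eqP; rewrite mulr0.
Qed.

End JordanChains.

(** * The star operation on scalars and matrices *)

Section Star.
Variables (R : realType) (K : ground_field).
Local Notation C := R[i].

Lemma scalar_star_is_zmod_morphism : zmod_morphism (@scalar_star R K).
Proof. by case: K => x y //=; rewrite rmorphB. Qed.

Lemma scalar_star_is_monoid_morphism : monoid_morphism (@scalar_star R K).
Proof. by case: K; split => [|x y] //=; rewrite ?rmorph1 ?rmorphM. Qed.

(** With these instances the generic lemmas on ring morphisms and [map_mx] treat both ground fields
    at once. *)
HB.instance Definition _ := GRing.isZmodMorphism.Build C C (@scalar_star R K)
  scalar_star_is_zmod_morphism.
HB.instance Definition _ := GRing.isMonoidMorphism.Build C C (@scalar_star R K)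
  scalar_star_is_monoid_morphism.

Lemma scalar_starK : involutive (@scalar_star R K).
Proof. by case: K => x //=; rewrite conjCK. Qed.

Lemma scalar_star_eps2 S : scalar_star K (eps2 S) = eps2 S :> C.
Proof. by case: S; rewrite /= ?rmorphN rmorph1. Qed.

Lemma starK m n (M : 'M[C]_(m, n)) : star K (star K M) = M.
Proof. by apply/matrixP => i j; rewrite !mxE scalar_starK. Qed.

Lemma star0 m n : star K (0 : 'M[C]_(m, n)) = 0.
Proof. by rewrite /star trmx0 map_mx0. Qed.

Lemma starB m n (M N : 'M[C]_(m, n)) : star K (M - N) = star K M - star K N.
Proof. by apply/matrixP => i j; rewrite !mxE rmorphB. Qed.

Lemma star_scalar n (a : C) : star K (a%:M : 'M_n) = (scalar_star K a)%:M.
Proof. by rewrite /star tr_scalar_mx map_scalar_mx. Qed.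

Lemma starM m n p (M : 'M[C]_(m, n)) (N : 'M_(n, p)) :
  star K (M *m N) = star K N *m star K M.
Proof. by rewrite /star trmx_mul map_mxM. Qed.

Lemma starX n (M : 'M[C]_n) k : star K (M ^+ k) = star K M ^+ k.
Proof.
elim: k => [|k IH]; first by rewrite !expr0 star_scalar rmorph1.
by rewrite exprS exprSr -!mulmxE starM IH.
Qed.

Lemma star_row_mx m n p (M : 'M[C]_(m, n)) (N : 'M_(m, p)) :
  star K (row_mx M N) = col_mx (star K M) (star K N).
Proof. by rewrite /star tr_row_mx map_col_mx. Qed.

Lemma mxrank_star m n (M : 'M[C]_(m, n)) : \rank (star K M) = \rank M.
Proof. by rewrite /star mxrank_map mxrank_tr. Qed.

End Star.

Lemma eps2K (R : realType) S : eps2 S * eps2 S = 1 :> R[i].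
Proof. by case: S; rewrite /= ?mulrNN mulr1. Qed.

Lemma eps2X_neq0 (R : realType) S m : eps2 S ^+ m != 0 :> R[i].
Proof. by rewrite expf_neq0 //; case: S; rewrite /= ?oppr_eq0 oner_eq0. Qed.

Lemma eps2_star_involutive (R : realType) K S :
  involutive (fun a : R[i] => eps2 S * scalar_star K a).
Proof.
by move=> a; rewrite rmorphM /= scalar_star_eps2 scalar_starK mulrA eps2K mul1r.
Qed.

(** * Interaction of a structured matrix with the form *)

Section Structured.
Variables (R : realType) (K : ground_field) (S : matrix_class) (n : nat).
Variables (eps1 : R[i]) (H A : 'M[R[i]]_n).
Hypotheses (formH : form_matrix K eps1 H) (classA : in_class K S H A).
Local Notation mu a := (eps2 S * scalar_star K a).

Lemma form_unitmx : H \in unitmx.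
Proof. by case: formH => _ _ /unitarymx_unit. Qed.

Lemma eps1K : eps1 * eps1 = 1.
Proof. by case: formH => -[] -> _ _ _; rewrite ?mulrNN mulr1. Qed.

Lemma star_form : star K H = eps1 *: H.
Proof. by case: formH. Qed.

Lemma star_mul_form : star K A *m H = eps2 S *: (H *m A).
Proof.
have adjA : adj K H A = eps2 S *: A.
  by case: S classA => -[_ ->]; rewrite /= ?scaleN1r ?scale1r.
have := congr1 (mulmx H) adjA; rewrite /adj -mulmxA -scalemxAr.
by rewrite (mulKVmx form_unitmx).
Qed.

(** The scalar matches because [eps2 S * eps2 S = 1] gives [eps2 S * mu a = scalar_star K a]. *)
Lemma form_mul_shift a :
  star K (A - a%:M) *m H = eps2 S *: (H *m (A - (mu a)%:M)).
Proof.
rewrite starB star_scalar mulmxBl star_mul_form mulmxBr scalerBr.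
by rewrite mul_scalar_mx mul_mx_scalar scalerA mulrA eps2K mul1r.
Qed.

Lemma form_mul_shiftX a m :
  star K ((A - a%:M) ^+ m) *m H
  = eps2 S ^+ m *: (H *m (A - (mu a)%:M) ^+ m).
Proof.
rewrite starX; elim: m => [|m IH].
  by rewrite !expr0 mul1mx mulmx1 scale1r.
rewrite exprSr -mulmxE -mulmxA form_mul_shift -scalemxAr mulmxA IH.
by rewrite -scalemxAl scalerA -exprS -mulmxA mulmxE -exprSr.
Qed.

(** Rank is unchanged by star, by the invertible [H] on either side and by the nonzero scalar
    [eps2 S ^+ m]. *)
Lemma mxrank_shiftX a m :
  \rank ((A - (mu a)%:M) ^+ m) = \rank ((A - a%:M) ^+ m).
Proof.
have Hu := form_unitmx.
rewrite -[RHS](mxrank_star K) -[RHS](@mxrankMfree _ _ _ _ _ H); last first.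
  by rewrite row_free_unit.
rewrite form_mul_shiftX mxrank_scale_nz ?eps2X_neq0 //.
rewrite -[RHS]mxrank_tr trmx_mul mxrankMfree ?mxrank_tr //.
by rewrite row_free_unit unitmx_tr.
Qed.

Lemma eigenvalue_eps2_star a : eigenvalue A (mu a) = eigenvalue A a.
Proof. by rewrite !eigenvalue_mxrank -[A - _]expr1 mxrank_shiftX. Qed.

Lemma jordan_chains_orthogonal k1 k2 a1 a2 (X1 : 'M_(n, k1)) (X2 : 'M_(n, k2)) :
  A *m X1 = X1 *m jordan_block k1 a1 -> A *m X2 = X2 *m jordan_block k2 a2 ->
  a2 <> mu a1 -> star K X1 *m H *m X2 = 0.
Proof.
move=> AX1 AX2 /eqP a12.
have X1A : star K ((A - a1%:M) ^+ k1 *m X1) *m H *m X2 = 0.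
  rewrite (jordan_chainX _ _ AX1) subrr jordan_block0X_eq0 //.
  by rewrite mulmx0 star0 !mul0mx.
have Junit : jordan_block k2 (a2 - mu a1) ^+ k1 \in unitmx.
  by rewrite jordan_blockX_unit // subr_eq0.
(* Carried across [H], the power acts on [X2]; what vanishes is a nonzero multiple of the desired
   product times an invertible block power. *)
move: X1A; rewrite starM -2!mulmxA [_ *m (H *m X2)]mulmxA form_mul_shiftX.
rewrite -!scalemxAl -mulmxA (jordan_chainX _ _ AX2) -scalemxAr => /eqP.
rewrite scaler_eq0 (negPf (eps2X_neq0 _ _ _)) /= !mulmxA => /eqP.
move/(congr1 (mulmx^~ (invmx (jordan_block k2 (a2 - mu a1) ^+ k1)))).
by rewrite (mulmxK Junit) mul0mx.
Qed.

Lemma star_form_mulC k1 k2 (X : 'M_(n, k1)) (Y : 'M_(n, k2)) :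
  star K Y *m H *m X = eps1 *: star K (star K X *m H *m Y).
Proof.
rewrite !starM starK star_form -scalemxAl -scalemxAr scalerA eps1K scale1r.
by rewrite mulmxA.
Qed.

(** The lower left block is expressed through the upper right one, so one orthogonality relation
    clears both. *)
Lemma gram_row_mx k1 k2 (X : 'M_(n, k1)) (Y : 'M_(n, k2)) :
  star K (row_mx X Y) *m H *m row_mx X Y =
  block_mx (star K X *m H *m X) (star K X *m H *m Y)
           (eps1 *: star K (star K X *m H *m Y)) (star K Y *m H *m Y).
Proof. by rewrite star_row_mx mul_col_mx mul_col_row (star_form_mulC X Y). Qed.

Lemma jordan_pair_eps2_star k a (X : 'M_(n, k)) :
  jordan_pair A a X -> exists Xt : 'M_(n, k), jordan_pair A (mu a) Xt.
Proof.
move=> AX; have [k0 eigA _ _] := AX.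
apply: (jordan_pair_exists k0); first by rewrite eigenvalue_eps2_star.
by rewrite (mxrank_shiftX a k) (mxrank_shiftX a k.-1) (jordan_pair_mxrank AX).
Qed.

(** Up to the common factor [eps1], the left side is [star K x *m H *m A]; moving [A] across [H]
    onto [x] produces the scalar [eps2 S * scalar_star K a], which is [a]. *)
Lemma left_eigenvector_form a x :
  a = mu a -> right_eigenvector A a x -> left_eigenvector K A a (H *m x).
Proof.
move=> aE [x0 Ax]; split.
  apply: contra_neq x0 => Hx0.
  by rewrite -(mulKmx form_unitmx x) Hx0 mulmx0.
have -> : star K (H *m x) = eps1 *: (star K x *m H).
  by rewrite starM star_form -scalemxAr.
rewrite -scalemxAl -mulmxA [RHS]scalerA mulrC -scalerA; congr (_ *: _).
have -> : H *m A = eps2 S *: (star K A *m H).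
  by rewrite star_mul_form scalerA eps2K scale1r.
have starZ : star K (a *: x) = scalar_star K a *: star K x.
  by apply/matrixP => i j; rewrite !mxE rmorphM.
by rewrite -scalemxAr mulmxA -starM Ax starZ -scalemxAl scalerA -aE.
Qed.

End Structured.

(** The zero matrix lies in both classes and its eigenvalue 0 is fixed by mu; for [H] the identity,
    a standard basis vector has form value 1. *)
Lemma unit_form_not_isotropic (R : realType) K S n : (0 < n)%N ->
  exists (H A : 'M[R[i]]_n) (x : 'cV_n),
    [/\ form_matrix K 1 H, in_class K S H A, eigenvalue A 0,
        right_eigenvector A 0 x & ip K H x x != 0].
Proof.
move=> n_gt0; pose i0 := Ordinal n_gt0.
pose x : 'cV[R[i]]_n := delta_mx i0 0.
have x0 : x != 0.
  by apply/cV0Pn; exists i0; rewrite mxE !eqxx oner_eq0.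
exists 1%:M, 0, x; split.
- split; first by left.
  + case: K => //=; apply/mxOverP => i j; rewrite mxE.
    by case: (i == j); rewrite ?real1 ?real0.
  + by apply/unitarymxP; rewrite trmx1 map_mx1 mulmx1.
  + by rewrite star_scalar rmorph1 scale1r.
- split.
    by case: K => //=; apply/mxOverP => i j; rewrite mxE real0.
  by rewrite /adj star0 mulmx0 mul0mx; case: S; rewrite ?oppr0.
- rewrite eigenvalue_mxrank raddf0 subr0 mxrank0.
  by rewrite neq_ltn n_gt0.
- by split => //; rewrite mul0mx scale0r.
- rewrite /ip mulmx1 mxE (bigD1 i0) //= big1 => [|i ii0].
    by rewrite !mxE !eqxx rmorph1 mulr1 addr0 oner_eq0.
  by rewrite !mxE (negPf ii0) mulr0.
Qed.

Theorem proposition3p1 (R : realType) (K : ground_field) (S : matrix_class)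
    (n : nat) (n_gt0 : (0 < n)%N) :
  (forall (eps1 : R[i]) (H A : 'M[R[i]]_n),
    form_matrix K eps1 H -> in_class K S H A ->
    (* (a) *)
    (forall lambda : R[i],
       (eigenvalue A lambda <-> eigenvalue A (eps2 S * scalar_star K lambda))
       /\
       (eigenvalue A lambda ->
        forall s : seq (R[i] * nat), jordan_form A s ->
        perm_eq (partial_mults s (eps2 S * scalar_star K lambda))
                (partial_mults s lambda)))
    /\
    (* (b) *)
    ((forall (k1 k2 : nat) (lambda1 lambda2 : R[i])
             (X1 : 'M[R[i]]_(n, k1)) (X2 : 'M[R[i]]_(n, k2)),
        jordan_pair A lambda1 X1 -> jordan_pair A lambda2 X2 ->
        lambda2 <> eps2 S * scalar_star K lambda1 ->
        star K X1 *m H *m X2 = 0 /\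
        star K (row_mx X1 X2) *m H *m row_mx X1 X2 =
          block_mx (star K X1 *m H *m X1) 0
                   0                      (star K X2 *m H *m X2))
     /\
     (forall (k : nat) (lambda : R[i]) (X : 'M[R[i]]_(n, k)),
        jordan_pair A lambda X -> lambda <> eps2 S * scalar_star K lambda ->
        star K X *m H *m X = 0))
    /\
    (* (c) *)
    (forall (k : nat) (lambda : R[i]) (X : 'M[R[i]]_(n, k)),
       jordan_pair A lambda X -> lambda <> eps2 S * scalar_star K lambda ->
       exists Xt : 'M[R[i]]_(n, k),
         jordan_pair A (eps2 S * scalar_star K lambda) Xt /\
         star K (row_mx X Xt) *m H *m row_mx X Xt =
           block_mx 0                                  (star K X *m H *m Xt)
                    (eps1 *: star K (star K X *m H *m Xt)) 0)
    /\
    (* (d), first part *)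
    (forall (lambda : R[i]) (x : 'cV[R[i]]_n),
       lambda = eps2 S * scalar_star K lambda ->
       eigenvalue A lambda -> right_eigenvector A lambda x ->
       left_eigenvector K A lambda (H *m x)))
  /\
  (* (d), second part *)
  ~ (forall (eps1 : R[i]) (H A : 'M[R[i]]_n) (lambda : R[i]) (x : 'cV[R[i]]_n),
       form_matrix K eps1 H -> in_class K S H A ->
       lambda = eps2 S * scalar_star K lambda ->
       eigenvalue A lambda -> right_eigenvector A lambda x ->
       ip K H x x = 0).
Proof.
split=> [eps1 H A formH classA|allH]; last first.
  have [H [A [x [formH classA eigA Ax /eqP]]]] :=
    unit_form_not_isotropic R K S n_gt0.
  apply; apply: (allH _ _ _ _ _ formH classA _ eigA Ax).
  by rewrite rmorph0 mulr0.
split=> [lambda|].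
  rewrite (eigenvalue_eps2_star formH classA); split=> // _ s As.
  apply: (perm_partial_mults As) => m.
  exact: (mxrank_shiftX formH classA lambda m).
split.
  split=> [k1 k2 a1 a2 X1 X2 [_ _ _ AX1] [_ _ _ AX2] a12|k a X [_ _ _ AX] aa].
    have X12 := jordan_chains_orthogonal formH classA AX1 AX2 a12.
    by rewrite (gram_row_mx formH) X12 star0 scaler0.
  exact: (jordan_chains_orthogonal formH classA AX AX aa).
split=> [k a X AX aa|a x aE _]; last first.
  exact: (left_eigenvector_form formH classA aE).
have [Xt AXt] := jordan_pair_eps2_star formH classA AX.
have [[_ _ _ JX] [_ _ _ JXt]] := (AX, AXt).
exists Xt; split=> //; rewrite (gram_row_mx formH).
rewrite (jordan_chains_orthogonal formH classA JX JX aa).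
(* The lower right block vanishes if mu(a) differs from mu(mu(a)); as mu is an involution, this is
   [aa] with its sides exchanged. *)
rewrite (jordan_chains_orthogonal formH classA JXt JXt) //.
by rewrite eps2_star_involutive => /esym.
Qed.
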